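(* For every admissible index $i$ (i.e. $1\le i\le n$ if $s>n-1$, and $2\le i\le n$ if $s=n-1$), the irreducible component $K^i$ of $Y$ is given by \[ K^i=\{V_\bullet\in \mathrm{Fl}(1^n,s-1)\ \mid\ V_{i-1}\subseteq \mathrm{im}(x)\subseteq V_n\subseteq x^{-1}V_{i-1}\}, \] where $x^{-1}V_{i-1}$ denotes the preimage of $V_{i-1}$ under the linear map $x$.
   Context: Fix integers $n\ge 2$ and $s\ge n-1$, let $N=n+s-1$, and let $e_1,\dots,e_N$ be the standard basis of $\mathbb{C}^N$. Let $x:\mathbb{C}^N\to\mathbb{C}^N$ be the linear map with $xe_m=e_{m-(n-1)}$ for $n\le m\le 2n-2$ and $xe_m=0$ otherwise; thus $\mathrm{im}(x)=\mathrm{span}(e_1,\dots,e_{n-1})$ and $x$ is nilpotent of Jordan type $(2^{n-1},1^{s-n+1})$. Let $\mathrm{Fl}(1^n,s-1)$ be the variety of partial flags $V_\bullet=(0=V_0\subset V_1\subset\cdots\subset V_n\subset\mathbb{C}^N)$ with $\dim V_j=j$. The $\Delta$-Springer fiber is the closed subvariety $Y=Y_{n,(1^{n-1}),s}=\{V_\bullet\in\mathrm{Fl}(1^n,s-1)\mid \mathrm{im}(x)\subseteq V_n,\ xV_j\subseteq V_j \text{ for all } j\}$. For a sequence $w=(w_1,\dots,w_n)$ of distinct elements of $\{1,\dots,N\}$, the Schubert cell $X_w^\circ\subseteq \mathrm{Fl}(1^n,s-1)$ is the set of flags with $\dim(V_j\cap\mathrm{span}(e_1,\dots,e_m))=\#\{l\le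 j: w_l\le m\}$ for all $j,m$. For an admissible $i$ (namely $1\le i\le n$ if $s>n-1$, and $2\le i\le n$ if $s=n-1$) put $w^{(i)}=(n-1,n-2,\dots,n-i+1,\,N,\,n-i,n-i-1,\dots,1)$ and define $K^i$ to be the closure in $Y$ of $X^\circ_{w^{(i)}}\cap Y$. (It is known that these $K^i$ are exactly the irreducible components of $Y$, and that $Y$ has dimension $\binom{n-1}{2}+(s-1)$.) *)

(* Defs.v *)
(* mathcomp algebra (mxalgebra) + real_closed complex numbers
   over an arbitrary realType R (any realType is isomorphic to the reals, so
   complex R is the field of complex numbers). *)
From HB Require Import structures.
From mathcomp Require Import all_boot all_order all_algebra.
From mathcomp Require Import reals.
From mathcomp Require Import complex.
Set Implicit Arguments. Unset Strict Implicit. Unset Printing Implicit Defensive.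
Import Order.TTheory GRing.Theory Num.Theory.
Local Open Scope ring_scope.

(* Conventions: vectors of C^N are row vectors 'rV_N, linear maps act on the
   right (v |-> v *m A), subspaces are row spaces of matrices (mxalgebra).
   Basis index m (1-based in the paper) is the ordinal m-1 here. *)

Section Defs.
Variable R : realType.
Local Notation C := (complex R).

(* The nilpotent map x : e_m |-> e_{m-(n-1)} for n <= m <= 2n-2 (1-based),
   i.e. for 0-based k with n-1 <= k <= 2n-3, e_k |-> e_{k-(n-1)}.
   In row convention, row k of the matrix is the image of e_k. *)
Definition xmap (n N : nat) : 'M[C]_N :=
  \matrix_(k < N, l < N)
    (if ((n.-1 <= k) && (k <= 2 * n - 3) && (l == k - n.-1 :> nat))%N
     then 1 else 0).

Definition Espan (N m : nat) : 'M[C]_N := pid_mx m.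

(* A partial flag V_1 < ... < V_n in C^N (dim V_j = j) is represented by a
   frame B : 'M_(n, N) of rank n (row_free); V_j is the span of its first j
   rows. Every flag arises so, and two frames give the same flag iff
   they have the same V_j for all j. *)
Definition Vj (n N : nat) (B : 'M[C]_(n, N)) (j : nat) : 'M[C]_(n, N) :=
  pid_mx j *m B.

Definition is_frame (n N : nat) (B : 'M[C]_(n, N)) : bool := row_free B.

Definition same_flag (n N : nat) (B B' : 'M[C]_(n, N)) : Prop :=
  forall j : nat, (j <= n)%N -> (Vj B j == Vj B' j)%MS.

Definition inY (n N : nat) (B : 'M[C]_(n, N)) : Prop :=
  (xmap n N <= Vj B n)%MS /\
  forall j : nat, (j <= n)%N -> (Vj B j *m xmap n N <= Vj B j)%MS.

(* Schubert cell X_w^o for a sequence w = (w_1, ..., w_n) (1-based values). *)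
Definition inSchubertCell (n N : nat) (w : seq nat) (B : 'M[C]_(n, N)) : Prop :=
  forall j m : nat, (j <= n)%N -> (m <= N)%N ->
    \rank (Vj B j :&: Espan N m)%MS = count (fun a => a <= m)%N (take j w).

Definition w_i (n N i : nat) : seq nat :=
  [seq (n - k)%N | k <- iota 1 i.-1] ++ N :: [seq (n - i - k)%N | k <- iota 0 (n - i)].

Definition mx_cvg (p q : nat) (Bk : nat -> 'M[C]_(p, q)) (B : 'M[C]_(p, q)) : Prop :=
  forall eps : R, 0 < eps -> exists K : nat, forall k : nat, (K <= k)%N ->
    forall (a : 'I_p) (b : 'I_q), `|Bk k a b - B a b| < Complex eps 0.

(* Closure in Fl(1^n, s-1) (Euclidean topology, quotient topology from frames)
   of a set of flags S given as a predicate on frames. *)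
Definition in_closure (n N : nat) (S : 'M[C]_(n, N) -> Prop) (B : 'M[C]_(n, N)) : Prop :=
  exists (Bk : nat -> 'M[C]_(n, N)) (B' : 'M[C]_(n, N)),
    (forall k, is_frame (Bk k) /\ S (Bk k)) /\ mx_cvg Bk B' /\
    is_frame B' /\ same_flag B' B.

(* K^i := closure in Y of X^o_{w^(i)} cap Y. Y is closed, so this is
   Y cap closure. *)
Definition inK (n N i : nat) (B : 'M[C]_(n, N)) : Prop :=
  inY B /\ in_closure (fun B0 => inY B0 /\ inSchubertCell (w_i n N i) B0) B.

Definition in_preimage (p N : nat) (X : 'M[C]_N) (W : 'M[C]_(p, N)) (v : 'rV[C]_N) : Prop :=
  (v *m X <= W)%MS.


End Defs.
Arguments xmap {R} n N.
Arguments Espan {R} N m.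

(* Main.v *)
(* On the cell of w^(i), V_(i-1) lies in im x, and V_n = V_i + im x with
   x^2 = 0, so x V_n <= V_i \cap im x = V_(i-1); these inclusions are closed
   conditions, hence hold on K^i.  Conversely, the frames of flags
   satisfying the inclusions are the full-rank matrices in the image of an
   affine space under a polynomial map.  On this image the ranks defining the cell of w^(i) are
   bounded above by their values on the cell, and the coordinate flag of w^(i)
   attains these values.  Along the line in parameter space from a given flag
   to the coordinate flag, all but finitely many points therefore lie in the
   cell, and a sequence of them converges to the given flag. *)
Require Import Defs.
From HB Require Import structures.
From mathcomp Require Import all_boot all_order all_algebra perm.
From mathcomp Require Import boolp classical_sets filter topology normedtype sequences.
From mathcomp Require Import reals complex.
From mathcomp Require Import zify.
Import Order.TTheory GRing.Theory Num.Theory.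
Import numFieldNormedType.Exports.
Local Open Scope ring_scope.
Set Implicit Arguments.
Unset Strict Implicit.
Unset Printing Implicit Defensive.

(** * Limits of matrices *)

Section EntrywiseLimits.
Local Open Scope classical_set_scope.
Variable F : numFieldType.

(** Stated with filters, so that the limit rules for sums and products apply; [mx_cvgP] translates
    to and from [mx_cvg]. *)
Definition entrywise_cvg (p q : nat) (A : nat -> 'M[F]_(p, q)) (L : 'M[F]_(p, q)) :=
  forall a b, (fun k => A k a b) @ \oo --> L a b.

Lemma entrywise_cvg_cst (p q : nat) (L : 'M[F]_(p, q)) :
  entrywise_cvg (fun=> L) L.
Proof. by move=> a b; exact: cvg_cst. Qed.

Lemma cvg_sum_fin (I : Type) (r : seq I) (P : pred I)
    (u : I -> nat -> F) (l : I -> F) :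
  (forall i, u i @ \oo --> l i) ->
  (fun k => \sum_(i <- r | P i) u i k) @ \oo --> \sum_(i <- r | P i) l i.
Proof.
move=> ul; elim: r => [|i r IH].
  by under eq_fun do rewrite big_nil; rewrite big_nil; exact: cvg_cst.
under eq_fun do rewrite big_cons; rewrite big_cons; case: ifP => // _.
exact: (cvgD (ul i) IH).
Qed.

Lemma cvg_prod_fin (I : Type) (r : seq I) (P : pred I)
    (u : I -> nat -> F) (l : I -> F) :
  (forall i, u i @ \oo --> l i) ->
  (fun k => \prod_(i <- r | P i) u i k) @ \oo --> \prod_(i <- r | P i) l i.
Proof.
move=> ul; elim: r => [|i r IH].
  by under eq_fun do rewrite big_nil; rewrite big_nil; exact: cvg_cst.
under eq_fun do rewrite big_cons; rewrite big_cons; case: ifP => // _.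
exact: (cvgM (ul i) IH).
Qed.

Lemma entrywise_cvg_mul (p q r : nat) (A : nat -> 'M[F]_(p, q))
    (B : nat -> 'M_(q, r)) LA LB :
  entrywise_cvg A LA -> entrywise_cvg B LB ->
  entrywise_cvg (fun k => A k *m B k) (LA *m LB).
Proof.
move=> cA cB a b; rewrite mxE; under eq_fun do rewrite mxE.
by apply: cvg_sum_fin => j; exact: (cvgM (cA a j) (cB j b)).
Qed.

Lemma cvg_det (p : nat) (A : nat -> 'M[F]_p) L :
  entrywise_cvg A L -> (fun k => \det (A k)) @ \oo --> \det L.
Proof.
move=> cA; apply: cvg_sum_fin => s.
have cP : (fun k => \prod_i A k i (s i)) @ \oo --> \prod_i L i (s i).
  by apply: cvg_prod_fin => a; exact: cA.
exact: (cvgM (@cvg_cst F ((-1) ^+ s) _ _ _) cP).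
Qed.

Lemma entrywise_cvg_adj (p : nat) (A : nat -> 'M[F]_p) L :
  entrywise_cvg A L -> entrywise_cvg (fun k => \adj (A k)) (\adj L).
Proof.
move=> cA a b; rewrite mxE; under eq_fun do rewrite mxE.
have cM : (fun k => \det (row' b (col' a (A k)))) @ \oo --> \det (row' b (col' a L)).
  apply: cvg_det => c d; rewrite !mxE; under eq_fun do rewrite !mxE.
  exact: cA.
exact: (cvgM (@cvg_cst F ((-1) ^+ (b + a)) _ _ _) cM).
Qed.

Lemma entrywise_cvg_unique (p q : nat) (A : nat -> 'M[F]_(p, q)) L L' :
  entrywise_cvg A L -> entrywise_cvg A L' -> L = L'.
Proof.
move=> cL cL'; apply/matrixP => a b.
exact: (cvg_unique (@norm_hausdorff _ _) (cL a b) (cL' a b)).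
Qed.

(* With [C] a right inverse of [lim B], Cramer's rule turns the inclusions
   [A k <= pid_mx r *m B k] into polynomial identities in the entries of [A k]
   and [B k], which survive in the limit because [\det (lim B *m C) = 1]. *)
Lemma entrywise_cvg_submx (p q m r : nat) (A : nat -> 'M[F]_(p, q))
    (B : nat -> 'M[F]_(m, q)) LA LB :
  entrywise_cvg A LA -> entrywise_cvg B LB -> row_free LB ->
  (forall k, (A k <= (pid_mx r : 'M_m) *m B k)%MS) ->
  (LA <= (pid_mx r : 'M_m) *m LB)%MS.
Proof.
move=> cA cB /row_freeP[C LBC] sAB.
pose D k := \det (B k *m C).
have cBC : entrywise_cvg (fun k => B k *m C) (LB *m C).
  by apply: entrywise_cvg_mul => //; exact: entrywise_cvg_cst.
pose E k := A k *m C *m \adj (B k *m C).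
have cE : entrywise_cvg E (LA *m C).
  rewrite -[LA *m C]mulmx1 -[1%:M](_ : \adj (LB *m C) = _); last first.
    by have := mul_mx_adj (LB *m C); rewrite LBC det1 mul1mx.
  apply: entrywise_cvg_mul; last exact: entrywise_cvg_adj.
  by apply: entrywise_cvg_mul => //; exact: entrywise_cvg_cst.
have cD (a b : nat) (M : nat -> 'M[F]_(a, b)) LM :
    entrywise_cvg M LM -> entrywise_cvg (fun k => D k *: M k) LM.
  move=> cM i j; under eq_fun do rewrite mxE; rewrite -[LM i j]mul1r.
  have cD1 : D @ \oo --> (1 : F) by rewrite -[1](@det1 _ m) -LBC; exact: cvg_det.
  exact: (cvgM cD1 (cM i j)).
(* Writing [A k] as [d *m (pid_mx r *m B k)] gives [E k = D k *: (d *m pid_mx r)]. Nothing is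
   divided by [D k], which may vanish for some [k]. *)
have Dk k : D k *: A k = E k *m (pid_mx r *m B k) /\ E k = E k *m pid_mx r.
  have /submxP[d Ad] := sAB k.
  have Ek : E k = D k *: (d *m pid_mx r).
    rewrite /E Ad !mulmxA -(mulmxA _ (B k)) -(mulmxA _ (B k *m C)).
    by rewrite mul_mx_adj mul_mx_scalar.
  have pp : (pid_mx r : 'M[F]_m) *m pid_mx r = (pid_mx r : 'M[F]_m).
    by rewrite mul_pid_mx minnn pid_mx_minv.
  rewrite Ek -!scalemxAl; split; last by rewrite -mulmxA pp.
  by rewrite mulmxA -(mulmxA d) pp -mulmxA -Ad.
have eqA : LA = LA *m C *m (pid_mx r *m LB).
  apply: (@entrywise_cvg_unique _ _ (fun k => D k *: A k)); first exact: cD.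
  move=> a b; under eq_fun do rewrite (Dk _).1.
  apply: (entrywise_cvg_mul cE _) => {a b}.
  by apply: entrywise_cvg_mul => //; exact: entrywise_cvg_cst.
by rewrite eqA submxMl.
Qed.

Lemma cvg_horner (u : nat -> F) (l : F) (P : {poly F}) :
  u @ \oo --> l -> (fun k => P.[u k]) @ \oo --> P.[l].
Proof.
move=> ul; elim/poly_ind: P => [|P c IH].
  by under eq_fun do rewrite horner0; rewrite horner0; exact: cvg_cst.
under eq_fun do rewrite hornerMXaddC; rewrite hornerMXaddC.
exact: (cvgD (cvgM IH ul) (@cvg_cst F c _ _ _)).
Qed.

End EntrywiseLimits.

Lemma mx_cvgP (R : realType) (p q : nat) (A : nat -> 'M[complex R]_(p, q)) L :
  mx_cvg A L <-> entrywise_cvg A L.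
Proof.
split=> [cA a b|cA e e0].
  (* A positive element of [complex R] has zero imaginary part, so its real part can serve as the
     tolerance. *)
  apply/cvgrPdist_lt => e; rewrite ltcE /= => /andP[/eqP e0 e1].
  have [K KP] := cA _ e1; exists K => // k /= Kk.
  rewrite distrC; apply: lt_le_trans (KP _ Kk a b) _.
  by case: e e0 e1 {KP} => x y /= ->.
have e0C : 0 < Complex e 0 by rewrite ltcE /= eqxx.
have : (\forall k \near \oo, forall ab : 'I_p * 'I_q,
    `|A k ab.1 ab.2 - L ab.1 ab.2| < Complex e 0)%classic.
  apply: filter_forall => -[a b] /=.
  have /cvgrPdist_lt/(_ _ e0C) := cA a b.
  by apply: filterS => k; rewrite distrC.
by case=> K _ KP; exists K => k Kk a b; exact: (KP k Kk (a, b)).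
Qed.

(** * The parametrisation *)

Section PartialIdentity.
Variable F : fieldType.

Lemma mulmx_pidE (p q r : nat) (A : 'M[F]_(p, q)) a b :
  (A *m (pid_mx r : 'M_q)) a b = A a b *+ (b < r)%N.
Proof.
rewrite mxE (bigD1 b) //= big1 ?addr0 => [|k /negPf kb].
  by rewrite mxE eqxx /=; case: ltnP => _; rewrite ?mulr1 ?mulr0.
by rewrite mxE [(k == b :> nat)]kb mulr0.
Qed.

Lemma mulmx_copidE (p q r : nat) (A : 'M[F]_(p, q)) a b :
  (A *m (copid_mx r : 'M_q)) a b = A a b *+ (r <= b)%N.
Proof.
rewrite mulmxBr mulmx1; transitivity (A a b - (A *m (pid_mx r : 'M_q)) a b).
  by rewrite !mxE.
by rewrite mulmx_pidE; case: ltnP => _; rewrite ?subrr ?subr0.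
Qed.

Lemma mul_pidmxE (p q r : nat) (A : 'M[F]_(p, q)) a b :
  ((pid_mx r : 'M_p) *m A) a b = A a b *+ (a < r)%N.
Proof.
rewrite mxE (bigD1 a) //= big1 ?addr0 => [|k /negPf ka].
  by rewrite mxE eqxx /=; case: ltnP => _; rewrite ?mul1r ?mul0r.
by rewrite mxE eq_sym [(k == a :> nat)]ka mul0r.
Qed.

Lemma pid_mx_sub (p q r r' : nat) (A : 'M[F]_(p, q)) :
  (r <= r')%N -> ((pid_mx r : 'M_p) *m A <= (pid_mx r' : 'M_p) *m A)%MS.
Proof.
move=> rr'; rewrite (_ : pid_mx r = pid_mx r *m (pid_mx r' : 'M_p)); last first.
  by rewrite mul_pid_mx (minn_idPl rr') pid_mx_minv.
by rewrite -mulmxA submxMl.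
Qed.

Lemma sub_pid_mxP (p q r : nat) (A : 'M[F]_(p, q)) :
  reflect (A = A *m (pid_mx r : 'M_q)) (A <= (pid_mx r : 'M_q))%MS.
Proof.
apply: (iffP idP) => [/submxP[d ->]|->]; last exact: submxMl.
by rewrite -mulmxA mul_pid_mx minnn pid_mx_minv.
Qed.

(** Rank-nullity for [copid_mx m], whose kernel is the span of the first [m] coordinates. It trades
    the intersections that define a Schubert cell for ranks of products. *)
Lemma rank_cap_pid_mx (p q m : nat) (A : 'M[F]_(p, q)) : (m <= q)%N ->
  (\rank (A *m copid_mx m) + \rank (A :&: (pid_mx m : 'M_q))%MS = \rank A)%N.
Proof.
move=> mq; rewrite -(mxrank_mul_ker A (copid_mx m)).
congr addn; apply/eqP; rewrite eqn_leq !mxrankS ?capmxS //.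
  apply/sub_pid_mxP/eqP; rewrite -subr_eq0 -{1}[kermx _]mulmx1 -mulmxBr.
  by rewrite -/(copid_mx m) mulmx_ker.
by apply/sub_kermxP; rewrite mul_pid_mx_copid.
Qed.

Lemma rank1_factor (p q : nat) (A : 'M[F]_(p, q)) : \rank A = 1%N ->
  exists (u : 'cV_p) (v : 'rV_q), A = u *m v /\ (v <= A)%MS.
Proof.
move=> rA; have nz : A != 0 by rewrite -mxrank_eq0 rA.
have vA : (nz_row A <= A)%MS by exact: nz_row_sub.
have : (A <= nz_row A)%MS.
  by rewrite -(mxrank_leqif_sup vA).2 rA rank_rV nz_row_eq0 nz.
by case/submxP=> u Au; exists u, (nz_row A).
Qed.

End PartialIdentity.

(* The flags with [V_(i-1) <= im x <= V_n <= x^-1 V_(i-1)] are parametrised by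
   an affine space: modulo [im x], [V_n] is spanned by a vector [v] with
   [v *m X = c *m V_(i-1)], i.e. [v] is [c *m V_(i-1) *m X^T] up to [ker x]. *)
Definition component_frame (K : comNzRingType) (n N i : nat) (X : 'M[K]_N)
    (H : 'M[K]_(n, N)) (u : 'cV[K]_n) (c : 'rV[K]_n) (w : 'rV[K]_N) :=
  H *m pid_mx n.-1 + copid_mx i.-1 *m u *m
    (c *m pid_mx i.-1 *m H *m pid_mx n.-1 *m X^T + w *m (1%:M - X *m X^T)).

(** Only ring operations occur in the formula. It can therefore be evaluated over [{poly F}] and
    then specialised at each [t]. *)
Lemma map_component_frame (K K' : comNzRingType) (f : {rmorphism K -> K'})
    (n N i : nat) (X : 'M[K]_N) (H : 'M[K]_(n, N)) u c w :
  map_mx f (component_frame i X H u c w) =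
  component_frame i (map_mx f X) (map_mx f H) (map_mx f u) (map_mx f c) (map_mx f w).
Proof.
by rewrite /component_frame !(map_copid_mx, map_mxB, map_mxD, map_mxM,
  map_pid_mx, map_mx1, map_trmx).
Qed.

Lemma component_frame_line (F : fieldType) (n N i : nat) (X : 'M[F]_N)
    (H H' : 'M[F]_(n, N)) u u' c c' w w' :
  exists G : 'M[{poly F}]_(n, N), forall t,
    map_mx (horner_eval t) G = component_frame i X (H + t *: (H' - H))
      (u + t *: (u' - u)) (c + t *: (c' - c)) (w + t *: (w' - w)).
Proof.
pose path p q (A A' : 'M[F]_(p, q)) := map_mx polyC A + 'X *: map_mx polyC (A' - A).
have pathE p q (A A' : 'M[F]_(p, q)) t :
    map_mx (horner_eval t) (path _ _ A A') = A + t *: (A' - A).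
  by apply/matrixP => a b; rewrite !mxE /horner_eval hornerD hornerM hornerX !hornerC.
exists (component_frame i (map_mx polyC X) (path _ _ H H') (path _ _ u u')
  (path _ _ c c') (path _ _ w w')) => t.
rewrite map_component_frame !pathE; congr component_frame.
by apply/matrixP => a b; rewrite !mxE /= /horner_eval hornerC.
Qed.

(** * Flags with the three inclusions, for a square-zero [X] with image [pid_mx n.-1] *)

Section ComponentFrames.
Variables (F : fieldType) (n N i : nat) (X : 'M[F]_N).
Hypotheses (n_gt0 : (0 < n)%N) (le_nN : (n.-1 <= N)%N).
Hypotheses (XTX : X^T *m X = pid_mx n.-1) (Xpi : X *m pid_mx n.-1 = X)
  (piX : (pid_mx n.-1 : 'M_N) *m X = 0).
Local Notation pi := (pid_mx n.-1 : 'M[F]_N).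
Local Notation p := (pid_mx i.-1 : 'M[F]_n).

Definition in_component (B : 'M[F]_(n, N)) :=
  [/\ (p *m B <= pi)%MS, (pi <= B)%MS & (B *m X <= p *m B)%MS].

Let pi_id : pi *m pi = pi.
Proof. by rewrite mul_pid_mx minnn pid_mx_minv. Qed.

Let p_id : p *m p = p.
Proof. by rewrite mul_pid_mx minnn pid_mx_minv. Qed.

Let p_copid : p *m copid_mx i.-1 = 0.
Proof. by rewrite mulmxBr mulmx1 p_id subrr. Qed.

Let rank_pi : \rank pi = n.-1.
Proof. by rewrite rank_pid_mx. Qed.

(** The factor [copid_mx i.-1] keeps the first [i.-1] rows in im x, and [v *m X] lies in V_(i-1).
    That V_n contains im x is a dimension count: [B] has rank [n] and lies in [pi + v], of rank at
    most [n]. *)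
Lemma component_frame_in (H : 'M[F]_(n, N)) u c w :
  let B := component_frame i X H u c w in row_free B -> in_component B.
Proof.
move=> B; rewrite /row_free => /eqP rB.
set v := c *m p *m H *m pi *m X^T + w *m (1%:M - X *m X^T).
have BE : B = H *m pi + copid_mx i.-1 *m u *m v by [].
have pB : p *m B = p *m H *m pi.
  by rewrite BE mulmxDr !mulmxA p_copid !mul0mx addr0.
have vX : v *m X = c *m (p *m B).
  (* [1%:M - X *m X^T] projects onto the kernel of [X]. *)
  have X0 : (1%:M - X *m X^T) *m X = 0.
    by rewrite mulmxBl mul1mx -mulmxA XTX Xpi subrr.
  by rewrite pB mulmxDl -(mulmxA w) X0 mulmx0 addr0 -!mulmxA XTX pi_id.
have Bs : (B <= pi + v)%MS by rewrite BE addmx_sub_adds ?submxMl.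
split; first by rewrite pB submxMl.
- apply: submx_trans (addsmxSl pi v) _.
  rewrite -(mxrank_leqif_sup Bs).2 eqn_leq mxrankS // rB.
  apply: leq_trans (mxrank_adds_leqif _ _).1 _.
  by rewrite rank_pi -[leqRHS](prednK n_gt0) -(addn1 n.-1) leq_add2l rank_leq_row.
- rewrite {1}BE mulmxDl -(mulmxA H) piX mulmx0 add0r -!mulmxA vX !mulmxA.
  by rewrite -mulmxA submxMl.
Qed.

(** [B] itself serves as [H]. As im x has codimension one in V_n, [B *m copid_mx n.-1] has rank one
    and factors as [u *m v]. Modulo im x the row [v] lies in V_n, so [v *m X] lies in V_(i-1), which
    supplies [c]; [v] also serves as [w]. *)
Lemma in_component_frame (B : 'M[F]_(n, N)) : row_free B -> in_component B ->
  exists u c w, B = component_frame i X B u c w.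
Proof.
rewrite /row_free => /eqP rB [/sub_pid_mxP pBE piB BX].
have r1 : \rank (B *m copid_mx n.-1) = 1%N.
  have := rank_cap_pid_mx B le_nN; rewrite rB.
  have -> : \rank (B :&: pi)%MS = n.-1.
    by rewrite (capmx_idPr piB).
  by move=> E; apply: (@addIn n.-1); rewrite E add1n prednK.
have [u [v [BC vB]]] := rank1_factor r1.
have /submxP[d vd] := vB.
have vX : v *m X = d *m (B *m X).
  rewrite vd -!mulmxA; congr (_ *m (_ *m _)).
  by rewrite mulmxBl mul1mx piX subr0.
have /submxP[e Be] := BX.
exists u, (d *m e), v.
(* The first [i.-1] rows of [B] lie in im x, so those rows of [u *m v] are already zero. *)
have puv : copid_mx i.-1 *m u *m v = u *m v.
  have pBC : p *m (B *m copid_mx n.-1) = 0.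
    by rewrite mulmxA mulmxBr mulmx1 -pBE subrr.
  by rewrite -mulmxA -BC mulmxBl mul1mx pBC subr0.
have -> : component_frame i X B u (d *m e) v =
    B *m pi + copid_mx i.-1 *m u *m v.
  rewrite /component_frame; congr (_ + _ *m _).
  have -> : d *m e *m p *m B *m pi = v *m X by rewrite vX Be pBE !mulmxA.
  by rewrite mulmxBr mulmx1 mulmxA addrC subrK.
by rewrite puv -BC mulmxBr mulmx1 addrC subrK.
Qed.

(** The first summand has rows in im x, of which at most [n.-1 - m] dimensions (truncated at zero)
    survive [copid_mx m]. The second has rank at most one, and vanishes when [j < i] or [m = N]. *)
Lemma rank_component_frame_le (H : 'M[F]_(n, N)) u c w (j m : nat) :
  (j <= n)%N -> (m <= N)%N ->
  (\rank ((pid_mx j : 'M_n) *m component_frame i X H u c w *m copid_mx m)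
     <= minn j (n.-1 - m + ((i <= j) && (m < N))))%N.
Proof.
move=> jn mN; rewrite leq_min; apply/andP; split.
  by rewrite -mulmxA (leq_trans (mxrankM_maxl _ _)) ?rank_pid_mx.
rewrite /component_frame mulmxDr mulmxDl.
set v := (_ + _ *m (1%:M - _)).
apply: leq_trans (mxrank_add _ _) _; apply: leq_add.
  rewrite -!mulmxA; apply: leq_trans (mxrankM_maxr _ _) _.
  apply: leq_trans (mxrankM_maxr _ _) _.
  have [nm|/ltnW mn] := leqP n.-1 m.
    suff -> : pi *m copid_mx m = 0 by rewrite mxrank0.
    by rewrite mulmxBr mulmx1 mul_pid_mx (minn_idPl nm) pid_mx_minv subrr.
  have /mxrankS : ((pid_mx m : 'M[F]_N) <= pi :&: (pid_mx m : 'M_N))%MS.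
    rewrite sub_capmx submx_refl andbT; apply/sub_pid_mxP.
    by rewrite mul_pid_mx (minn_idPl mn) pid_mx_minv.
  rewrite rank_pid_mx // => le_m; rewrite -(leq_add2r m) subnK //.
  by rewrite -[leqRHS]rank_pi -(rank_cap_pid_mx pi mN) leq_add2l.
have [ij|ji] := leqP i j; last first.
  have jp : (j <= i.-1)%N by rewrite -ltnS (leq_trans ji) ?leqSpred.
  have j_copid : (pid_mx j : 'M[F]_n) *m copid_mx i.-1 = 0.
    by rewrite mulmxBr mulmx1 mul_pid_mx (minn_idPl jp) pid_mx_minv subrr.
  by rewrite !mulmxA j_copid !mul0mx mxrank0.
have [mN'|Nm] := ltnP m N.
  rewrite -!mulmxA; do 3!apply: leq_trans (mxrankM_maxr _ _) _.
  exact: leq_trans (mxrankM_maxl _ _) (rank_leq_row _).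
by rewrite (_ : m = N) ?/copid_mx ?pid_mx_1 ?subrr ?mulmx0 ?mxrank0 //; lia.
Qed.

End ComponentFrames.

(** * Generic ranks and the coordinate flag *)

Section Generic.

(** This excludes only finitely many points, and the explicit polynomial turns finite conjunctions
    into products. *)
Definition generically (F : fieldType) (P : F -> Prop) :=
  exists2 q : {poly F}, q != 0 & forall t, ~~ root q t -> P t.

Lemma generically_forall (F : fieldType) (I : finType) (P : I -> F -> Prop) :
  (forall i, generically (P i)) -> generically (fun t => forall i, P i t).
Proof.
case/fin_all_exists2 => q q0 qP; exists (\prod_i q i).
  by apply/prodf_neq0 => i _; exact: q0.
move=> t; rewrite rootE horner_prod => /prodf_neq0 qt i.
by apply: qP; rewrite rootE qt.
Qed.

(* A nonvanishing minor at [t0] is a nonzero polynomial in [t]. *)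
Lemma generically_rank (F : fieldType) (p q : nat) (A : 'M[{poly F}]_(p, q)) (t0 : F) :
  generically (fun t => \rank (map_mx (horner_eval t0) A)
                          <= \rank (map_mx (horner_eval t) A))%N.
Proof.
set A0 := map_mx _ A.
(* [L] and [M] invert the factors of a rank factorisation of [A0], so [L *m A0 *m M = 1%:M] and
   [\det E] takes the value 1 at [t0]. *)
have /row_fullP[L LA] : row_full (col_base A0) by exact: col_base_full.
have /row_freeP[M AM] : row_free (row_base A0) by exact: row_base_free.
pose E := map_mx polyC L *m A *m map_mx polyC M.
have Et t : map_mx (horner_eval t) E = L *m map_mx (horner_eval t) A *m M.
  rewrite !map_mxM -!map_mx_comp /=.
  by congr (_ *m _ *m _); apply/matrixP => a b; rewrite !mxE /= /horner_eval hornerC.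
have detE t : (\det E).[t] = \det (L *m map_mx (horner_eval t) A *m M).
  by rewrite -Et det_map_mx.
exists (\det E).
  apply: contraTneq (oner_neq0 F) => E0.
  have LAM : L *m A0 *m M = 1%:M.
    by rewrite -[RHS]AM -(mul1mx (row_base A0)) -LA -(mulmxA L (col_base A0)) mulmx_base.
  by have := detE t0; rewrite E0 horner0 -/A0 LAM det1 => <-; rewrite eqxx.
move=> t; rewrite rootE detE -unitfE -unitmxE -row_full_unit /row_full => /eqP rE.
rewrite -{1}rE; apply: leq_trans (mxrankM_maxl _ _) _; exact: mxrankM_maxr.
Qed.

Local Open Scope classical_set_scope.

Lemma generically_cvg0 (F : numFieldType) (P : F -> Prop) :
  (forall e : F, 0 < e -> exists K : nat, e^-1 < K%:R) -> generically P ->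
  exists t : nat -> F, t @ \oo --> (0 : F) /\ forall k, P (t k).
Proof.
move=> arch [q q0 qP].
(* Among [size q] distinct reciprocals at least one is not a root of [q]. Whatever [a] is chosen,
   the point is at most 1/(k+1). *)
have ex k : exists a, ~~ root q ((k + a).+1%:R^-1).
  apply: contrapT => nex.
  pose rs := mkseq (fun a => ((k + a).+1%:R^-1 : F)) (size q).
  have : (size rs < size q)%N.
    apply: max_poly_roots => //.
      apply/allP => _ /mapP[a _ ->]; apply/negPn/negP => qa; apply: nex.
      by exists a.
    rewrite map_inj_uniq ?iota_uniq // => a b /invr_inj /eqP.
    by rewrite eqr_nat eqSS eqn_add2l => /eqP.
  by rewrite size_mkseq ltnn.
exists (fun k => (k + xchoose (ex k)).+1%:R^-1); split; last first.
  by move=> k; apply: qP; exact: xchooseP (ex k).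
apply/cvgrPdist_lt => e e0; have [K eK] := arch e e0.
exists K => // k /= Kk.
rewrite sub0r normrN ger0_norm ?invr_ge0 ?ler0n //.
rewrite -[ltRHS]invrK ltf_pV2 ?posrE ?invr_gt0 ?ltr0n //.
apply: lt_le_trans eK _.
by rewrite ler_nat (leq_trans Kk) // -addnS leq_addr.
Qed.

Lemma complex_archimedean (R : realType) (e : complex R) :
  0 < e -> exists K : nat, e^-1 < K%:R.
Proof.
rewrite ltcE /= => /andP[/eqP e0 _].
exists (Num.truncn (complex.Re e)^-1).+1.
have -> : e = (complex.Re e)%:C%C by case: e e0 => x y /= ->.
by rewrite -fmorphV -(rmorph_nat (real_complex R)) ltcR truncnS_gt.
Qed.

End Generic.

(** * Counting letters of the word of the cell *)

Section CellWord.

Lemma size_w_i (n N i : nat) : (1 <= i <= n)%N -> size (w_i n N i) = n.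
Proof. by move=> ?; rewrite /w_i size_cat /= !size_map !size_iota; lia. Qed.

(** Positions are 0-based and letters 1-based, so [N] stands at [l = i.-1]. *)
Lemma nth_w_i (n N i l : nat) : (1 <= i <= n)%N -> (l < n)%N ->
  nth 0%N (w_i n N i) l =
  if (l.+1 < i)%N then (n.-1 - l)%N else if l.+1 == i then N else (n - l)%N.
Proof.
move=> hi ln; rewrite /w_i nth_cat size_map size_iota.
case: ltnP => li.
  rewrite (nth_map 0%N) ?size_iota // nth_iota // ifT; lia.
rewrite ifF; last by lia.
case: eqP => [E|ne]; first by rewrite (_ : (l - i.-1)%N = 0%N) //; lia.
rewrite (_ : (l - i.-1)%N = (l - i).+1) /=; last by lia.
by rewrite (nth_map 0%N) ?size_iota ?nth_iota; lia.
Qed.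

Lemma w_i_uniq (n N i : nat) : (1 <= i <= n)%N -> (n <= N)%N -> uniq (w_i n N i).
Proof.
move=> hi nN; apply/(uniqP 0%N) => a b; rewrite !inE size_w_i // => an bn.
by rewrite !nth_w_i //; case: (ltnP a.+1 i) => ?; case: (ltnP b.+1 i) => ?;
  do ?case: eqP => ?; lia.
Qed.

Lemma w_i_range (n N i : nat) : (1 <= i <= n)%N -> (n <= N)%N ->
  all (fun a => 0 < a <= N)%N (w_i n N i).
Proof.
move=> hi nN; apply/(all_nthP 0%N) => a; rewrite size_w_i // => an.
by rewrite nth_w_i //; case: (ltnP a.+1 i) => ?; do ?case: eqP => ?; lia.
Qed.

(** Apart from [N], the letters decrease from [n.-1] to 1, so those above [m] come first; [N]
    accounts for the boolean. The value is exactly the bound of [rank_component_frame_le]. *)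
Lemma count_w_i_gt (n N i j m : nat) : (1 <= i <= n)%N -> (n <= N)%N ->
  (j <= n)%N -> (m <= N)%N ->
  count (fun a => m < a)%N (take j (w_i n N i)) =
  minn j (n.-1 - m + ((i <= j) && (m < N)))%N.
Proof.
move=> hi nN jn mN; elim: j jn => [|j IH] jn; first by rewrite take0 min0n.
rewrite (take_nth 0%N) ?size_w_i // -cats1 count_cat IH ?(ltnW jn) //=.
by rewrite nth_w_i //; case: (ltnP j.+1 i) => ?; do ?case: eqP => ?; lia.
Qed.

Lemma count_w_i_le (n N i j m : nat) : (1 <= i <= n)%N -> (n <= N)%N ->
  (j <= n)%N -> (m <= N)%N ->
  count (fun a => a <= m)%N (take j (w_i n N i)) =
  (j - minn j (n.-1 - m + ((i <= j) && (m < N))))%N.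
Proof.
move=> hi nN jn mN; rewrite -(@count_w_i_gt n N i j m) //.
have := count_predC (fun a => a <= m)%N (take j (w_i n N i)).
rewrite size_takel ?size_w_i //.
rewrite (@eq_count _ (predC _) (fun a => m < a)%N) => [E|a /=]; last by rewrite ltnNge.
by apply/esym/eqP; rewrite -{1}E addnK.
Qed.

End CellWord.

(** * Coordinate flags *)

Section WordFrame.
Variable F : fieldType.

Definition word_frame (n N : nat) (w : seq nat) : 'M[F]_(n, N) :=
  \matrix_(l, c) (c.+1 == nth 0%N w l)%:R.

Lemma rank_diag_indic (n : nat) (A : pred 'I_n) :
  \rank (diag_mx (\row_l (A l)%:R) : 'M[F]_n) = #|A|.
Proof.
pose S : 'M[F]_(#|A|, n) := \matrix_(a, l) (l == enum_val a)%:R.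
have SST : S *m S^T = 1%:M.
  apply/matrixP => a b; rewrite !mxE (bigD1 (enum_val a)) //= big1 => [|l la].
    by rewrite !mxE eqxx mul1r addr0 (inj_eq enum_val_inj).
  by rewrite !mxE (negPf la) mul0r.
have -> : diag_mx (\row_l (A l)%:R) = S^T *m S.
  apply/matrixP => k l; rewrite !mxE.
  under eq_bigr do rewrite !mxE.
  rewrite -(big_enum_val (fun x => (k == x)%:R * (l == x)%:R)) big_mkcond /=.
  rewrite (bigD1 k) //= big1 => [|x xk]; last first.
    by rewrite eq_sym (negPf xk) mul0r if_same.
  rewrite eqxx mul1r addr0 eq_sym unfold_in.
  by case: (A k); case: (l == k).
have fS : row_free S by apply/row_freeP; exists S^T.
by rewrite mxrankMfree // mxrank_tr; apply/eqP.
Qed.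

(** Distinct letters make the rows of [W] orthonormal. The truncated matrix is [D *m W], with [D]
    selecting the rows before [j] whose letter exceeds [m]; multiplying by [W^T] recovers [D]. *)
Lemma rank_word_frame (n N : nat) (w : seq nat) (j m : nat) :
  size w = n -> uniq w -> all (fun a => 0 < a <= N)%N w -> (j <= n)%N ->
  (count (fun a => m < a)%N (take j w) <=
   \rank ((pid_mx j : 'M_n) *m word_frame n N w *m copid_mx m))%N.
Proof.
move=> sw uw /(all_nthP 0%N) rw jn.
pose A := [pred l : 'I_n | (m < nth 0%N w l) && (l < j)]%N.
have -> : count (fun a => m < a)%N (take j w) = #|A|.
  rewrite -(map_nth_iota0 0%N) ?sw // count_map -sum1_count -sum1_card.
  rewrite -[j in iota 0 j]subn0 -/(index_iota 0 j) big_mkord.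
  by rewrite (big_ord_widen_cond _ (fun k => m < nth 0 w k)%N (fun=> 1%N) jn).
rewrite -rank_diag_indic.
set D := diag_mx _; set W := word_frame n N w.
have WWT : W *m W^T = 1%:M.
  apply/matrixP => a b; rewrite !mxE.
  have an : (a < size w)%N by rewrite sw.
  have bn : (b < size w)%N by rewrite sw.
  have a1N := rw a an.
  have cP : ((nth 0%N w a).-1 < N)%N by lia.
  rewrite (bigD1 (Ordinal cP)) //= big1 => [|c ca].
    rewrite !mxE /= prednK; last by lia.
    by rewrite eqxx mul1r nth_uniq // addr0.
  rewrite !mxE (_ : (_ == nth _ _ a) = false) ?mul0r //.
  by apply/negP => /eqP E; case/eqP: ca; apply: val_inj; rewrite /= -E.
have -> : (pid_mx j : 'M_n) *m W *m copid_mx m = D *m W.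
  apply/matrixP => a c.
  rewrite mul_diag_mx mulmx_copidE mul_pidmxE !mxE /=.
  have [<-|_] := eqVneq c.+1 (nth 0%N w a); last by rewrite mulr0 !mul0rn.
  by rewrite ltnS mulr1 -mulrnA mulnb andbC.
by rewrite -[X in (\rank X <= _)%N]mulmx1 -WWT mulmxA mxrankM_maxl.
Qed.

End WordFrame.

(** * Matrix identities for x *)

Section ShiftMatrix.
Variables (R : realType) (n N : nat).
Hypotheses (n_ge2 : (2 <= n)%N) (le_nN : (2 * n - 2 <= N)%N).
Local Notation X := (@xmap R n N).

Lemma xmapE k l : X k l = ((l < n.-1) && (k == l + n.-1 :> nat))%N%:R.
Proof.
rewrite mxE; case: ifP => [h|/negbT h].
  by rewrite (_ : _ && _ = true) //; lia.
by rewrite (_ : _ && _ = false) //; lia.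
Qed.

Lemma xmapTK : X^T *m X = pid_mx n.-1.
Proof.
apply/matrixP => a b; rewrite !mxE.
have [an|an] := ltnP a n.-1; last first.
  rewrite andbF big1 // => k _; rewrite !(mxE, xmapE).
  by rewrite ltnNge an mul0r.
(* The bound on [N] ensures that the basis vector mapped to the one of index [a] exists. *)
have aN : (a + n.-1 < N)%N by lia.
rewrite andbT (bigD1 (Ordinal aN)) //= big1 => [|k ka].
  rewrite mxE !xmapE /= an eqxx mul1r addr0 eqn_add2r.
  by congr (nat_of_bool _)%:R; lia.
rewrite mxE !xmapE an /= (_ : (_ == _) = false) ?mul0r //.
by apply/negP => /eqP E; case/eqP: ka; apply: val_inj.
Qed.

Lemma xmap_pid : X *m pid_mx n.-1 = X.
Proof.
apply/matrixP => a b; rewrite mulmx_pidE xmapE.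
by case: (ltnP b) => _; rewrite ?mulr1n ?mul0rn ?mulr0n.
Qed.

Lemma pid_xmap : (pid_mx n.-1 : 'M_N) *m X = 0.
Proof.
apply/matrixP => a b; rewrite mul_pidmxE xmapE [RHS]mxE.
case: (ltnP a n.-1) => an; last by rewrite mulr0n.
by rewrite (_ : _ && _ = false) ?mul0rn //; lia.
Qed.

Lemma xmap_eqmx : (X :=: (pid_mx n.-1 : 'M_N))%MS.
Proof.
apply/eqmxP/andP; split; first by rewrite -xmap_pid // submxMl.
by rewrite -xmapTK // submxMl.
Qed.

End ShiftMatrix.

(** * Components as closures of cells *)

Section Components.
Variables (R : realType) (n N i : nat).
Local Notation C := (complex R).
Local Notation X := (@xmap R n N).
Hypotheses (n_ge2 : (2 <= n)%N) (le_nN : (2 * n - 2 <= N)%N) (hi : (1 <= i <= n)%N).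

Let XTX := xmapTK R n_ge2 le_nN.
Let Xpi := xmap_pid R n_ge2 le_nN.
Let piX := pid_xmap R n_ge2 le_nN.
Let Xeq := xmap_eqmx R n_ge2 le_nN.
Let n_gt0 : (0 < n)%N. Proof. exact: ltnW. Qed.
Let le_n1N : (n.-1 <= N)%N. Proof. lia. Qed.
Let nN : (n <= N)%N. Proof. lia. Qed.

Lemma rank_Vj (B : 'M[C]_(n, N)) j : is_frame B -> (j <= n)%N -> \rank (Vj B j) = j.
Proof. by move=> fB jn; rewrite mxrankMfree // rank_pid_mx. Qed.

(** In this form the cell conditions can be compared with the upper bound on the parametrised family
    and with generic lower bounds. *)
Lemma inSchubertCellP (B : 'M[C]_(n, N)) : is_frame B ->
  inSchubertCell (w_i n N i) B <->
  (forall j m, (j <= n)%N -> (m <= N)%N ->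
     \rank (Vj B j *m copid_mx m) = minn j (n.-1 - m + ((i <= j) && (m < N)))%N).
Proof.
move=> fB; split=> cB j m jn mN; have := rank_cap_pid_mx (Vj B j) mN;
  rewrite rank_Vj //.
  rewrite cB // count_w_i_le // => /(canRL (addnK _)) ->.
  by rewrite subKn // geq_minl.
by rewrite cB // count_w_i_le // => /(canRL (addKn _)).
Qed.

(** For j <= i-1, V_j lies in im x and is killed by x; for larger j, x V_j lies in V_(i-1), hence in
    V_j. *)
Lemma in_component_inY (B : 'M[C]_(n, N)) : in_component i X B -> inY B.
Proof.
case=> pB piB BX; split; first by rewrite /Vj pid_mx_1 mul1mx Xeq.
move=> j jn; have [ji|ij] := leqP j i.-1.
  have /submxP[d Vd] : (Vj B j <= (pid_mx n.-1 : 'M_N))%MS.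
    by apply: submx_trans pB; exact: pid_mx_sub.
  by rewrite Vd -mulmxA piX mulmx0 sub0mx.
apply: submx_trans (pid_mx_sub B (ltnW ij)); apply: submx_trans BX.
by rewrite -mulmxA submxMl.
Qed.

Lemma cell_in_component (B : 'M[C]_(n, N)) : is_frame B -> inY B ->
  inSchubertCell (w_i n N i) B -> in_component i X B.
Proof.
move=> fB [XB VX] cB.
have piB : ((pid_mx n.-1 : 'M_N) <= B)%MS.
  by move: XB; rewrite /Vj pid_mx_1 mul1mx Xeq.
(* The cell condition at [m = n.-1], where the coordinate span is im x and [N] is the only letter
   beyond it. *)
have capV j : (j <= n)%N ->
    \rank (Vj B j :&: (pid_mx n.-1 : 'M_N))%MS = (j - (i <= j))%N.
  by move=> jn; rewrite cB // count_w_i_le //; lia.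
have i1n : (i.-1 <= n)%N by lia.
have VE : (Vj B i.-1 <= (pid_mx n.-1 : 'M_N))%MS.
  apply: submx_trans (capmxSr (Vj B i.-1) _).
  rewrite -(mxrank_leqif_sup (capmxSl _ _)).2 capV ?rank_Vj //; lia.
have VVi : (Vj B i.-1 <= Vj B i)%MS by apply: pid_mx_sub; exact: leq_pred.
have iN : (i <= n)%N by lia.
have capVi : (Vj B i :&: (pid_mx n.-1 : 'M_N) <= Vj B i.-1)%MS.
  have sV : (Vj B i.-1 <= Vj B i :&: (pid_mx n.-1 : 'M_N))%MS.
    by rewrite sub_capmx VVi VE.
  by rewrite -(mxrank_leqif_sup sV).2 capV // rank_Vj // leqnn subn1.
split=> //; apply: submx_trans capVi; rewrite sub_capmx.
rewrite -{2}Xpi mulmxA submxMl andbT.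
have sB : (Vj B i + (pid_mx n.-1 : 'M_N) <= B)%MS.
  by rewrite addsmx_sub submxMl piB.
(* The sum has dimension i + (n-1) - (i-1) = n. *)
have BV : (B <= Vj B i + (pid_mx n.-1 : 'M_N))%MS.
  rewrite -(mxrank_leqif_sup sB).2 (eqP fB).
  have := mxrank_sum_cap (Vj B i) (pid_mx n.-1 : 'M[C]_N).
  rewrite capV // rank_Vj // rank_pid_mx // leqnn.
  by move: (\rank _) => r; lia.
apply: submx_trans (submxMr X BV) _.
by rewrite addsmxMr addsmx_sub piX sub0mx andbT VX.
Qed.

(** Admissibility of [i] enters here. If [N] exceeds [2 * n - 2], then x e_N = 0 and [c = 0] works.
    Otherwise x e_N = e_(n-1), which must lie in V_(i-1); for [i >= 2] it is the first row of the
    frame. *)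
Lemma word_frame_component : (N = (2 * n - 2)%N -> (2 <= i)%N) ->
  exists u c w,
    word_frame C n N (w_i n N i) =
    component_frame i X (word_frame C n N (w_i n N i)) u c w.
Proof.
move=> hNi; set W := word_frame _ _ _ _.
have lastP : (N.-1 < N)%N by lia.
have iP : (i.-1 < n)%N by lia.
(* Row [i] (1-based), equal to e_N, is the only row outside im x; this dictates [w] and [u]. *)
pose w : 'rV[C]_N := delta_mx 0 (Ordinal lastP).
pose u : 'cV[C]_n := delta_mx (Ordinal iP) 0.
have [c wX] : exists c : 'rV_n,
    w *m X = c *m pid_mx i.-1 *m W *m (pid_mx n.-1 : 'M_N).
  have [E|ne] := eqVneq N (2 * n - 2)%N; last first.
    exists 0; rewrite !mul0mx -rowE; apply/rowP => k; rewrite mxE xmapE // mxE /=.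
    by rewrite (_ : _ && _ = false) //; apply/negP => /andP[]; lia.
  have i2 : (2 <= i)%N by exact: hNi.
  exists (delta_mx 0 (Ordinal n_gt0)).
  rewrite -!mulmxA -!rowE; apply/rowP => k; rewrite mxE xmapE // mxE.
  rewrite mul_pidmxE mulmx_pidE mxE nth_w_i //= ifT // subn0.
  rewrite (_ : (0 < i.-1)%N = true) ?mulr1n -?mulrnA ?mulnb; last by lia.
  by congr (nat_of_bool _)%:R; lia.
exists u, c, w; rewrite /component_frame -wX.
have -> : w *m X *m X^T + w *m (1%:M - X *m X^T) = w.
  by rewrite mulmxBr mulmx1 mulmxA addrC subrK.
have -> : copid_mx i.-1 *m u = u.
  rewrite mulmxBl mul1mx (_ : _ *m u = 0) ?subr0 //; apply/matrixP => a b.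
  rewrite mul_pidmxE !mxE; case: eqP => [->|_]; last by rewrite mul0rn.
  by rewrite /= ltnn mulr0n.
rewrite mul_delta_mx; apply/matrixP => l k; rewrite [RHS]mxE mulmx_pidE !mxE nth_w_i //.
rewrite -!val_eqE /=; case: (ltnP l.+1 i) => li.
  rewrite (_ : (_ && _) = false) ?addr0; last by lia.
  case: eqP => [E|_]; last by rewrite mul0rn.
  by rewrite (_ : (k < _)%N = true) //; lia.
have [E|ne] := eqVneq l.+1 i.
  rewrite (_ : (k.+1 == N) = (k == N.-1 :> nat)); last by lia.
  rewrite (_ : (l == i.-1 :> nat)%N = true) /=; last by lia.
  case: eqP => [Ek|_]; last by rewrite mul0rn addr0.
  by rewrite (_ : (k < _)%N = false) ?add0r //; lia.
rewrite (_ : (_ && _) = false) ?addr0; last by lia.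
case: eqP => [E|_]; last by rewrite mul0rn.
by rewrite (_ : (k < _)%N = true) //; lia.
Qed.

Lemma component_in_closure (B : 'M[C]_(n, N)) :
  (N = (2 * n - 2)%N -> (2 <= i)%N) -> is_frame B -> in_component i X B ->
  in_closure (fun B0 => inY B0 /\ inSchubertCell (w_i n N i) B0) B.
Proof.
move=> hNi fB cB.
have [u0 [c0 [w0 BE]]] := in_component_frame n_gt0 le_n1N piX fB cB.
have [u1 [c1 [w1 WE]]] := word_frame_component hNi.
pose H1 := word_frame C n N (w_i n N i).
have [G GE] := component_frame_line i X B H1 u0 u1 c0 c1 w0 w1.
pose Bt t := map_mx (horner_eval t) G.
have BtE t : Bt t = component_frame i X (B + t *: (H1 - B)) (u0 + t *: (u1 - u0))
    (c0 + t *: (c1 - c0)) (w0 + t *: (w1 - w0)) by exact: GE.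
have Bt0 : Bt 0 = B by rewrite BtE !scale0r !addr0 -BE.
have Bt1 : Bt 1 = word_frame C n N (w_i n N i).
  by rewrite BtE !scale1r !(addrC _ (_ - _)) !subrK -WE.
pose r j m := minn j (n.-1 - m + ((i <= j) && (m < N)))%N.
(* The coordinate flag at [t = 1] attains these finitely many lower bounds, so they hold for generic
   [t]. *)
have gen : generically (fun t => forall jm : 'I_n.+1 * 'I_N.+1,
    (r jm.1 jm.2 <= \rank (Vj (Bt t) jm.1 *m copid_mx jm.2))%N).
  apply: generically_forall => -[[j jn] [m mN]] /=.
  pose A := (pid_mx j : 'M[{poly C}]_n) *m G *m copid_mx m.
  have At t : map_mx (horner_eval t) A = Vj (Bt t) j *m copid_mx m.
    by rewrite !map_mxM map_copid_mx map_pid_mx.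
  have [q q0 qP] := generically_rank A 1.
  exists q => // t /qP; rewrite !At; apply: leq_trans.
  rewrite /r -(@count_w_i_gt n N i j m) // Bt1.
  by apply: rank_word_frame => //; [exact: size_w_i|exact: w_i_uniq|exact: w_i_range].
have [t [t0 rt]] := generically_cvg0 (@complex_archimedean R) gen.
have rk k j m : (j <= n)%N -> (m <= N)%N ->
    \rank (Vj (Bt (t k)) j *m copid_mx m) = r j m.
  move=> jn mN; apply/eqP; rewrite eqn_leq {1}/Vj {1}BtE.
  rewrite rank_component_frame_le //=.
  have jn1 : (j < n.+1)%N by []. have mN1 : (m < N.+1)%N by [].
  exact: (rt k (Ordinal jn1, Ordinal mN1)).
(* At [j = n], [m = 0] the prescribed rank is [n], and [copid_mx 0] is the identity. *)
have fBt k : is_frame (Bt (t k)).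
  have := rk k n 0 (leqnn n) (leq0n N).
  rewrite /Vj pid_mx_1 mul1mx /copid_mx pid_mx_0 subr0 mulmx1 /r.
  by rewrite /is_frame /row_free => ->; apply/eqP; lia.
exists (fun k => Bt (t k)), B; split; last split=> //.
- move=> k; split; first exact: fBt.
  split; last by apply/inSchubertCellP => // j m jn mN; exact: rk.
  apply: in_component_inY; rewrite BtE.
  by apply: component_frame_in => //; rewrite -BtE; exact: fBt.
- rewrite -Bt0; apply/mx_cvgP => a b; rewrite mxE.
  by under eq_fun do rewrite mxE; exact: cvg_horner.
- by split=> // j _; rewrite submx_refl.
Qed.

(** Two inclusions pass from the cell to the limit frame [B'] by [entrywise_cvg_submx], then to [B],
    which has the same flag; im x <= V_n is part of [inY B]. *)
Lemma closure_in_component (B : 'M[C]_(n, N)) :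
  inK i B -> in_component i X B.
Proof.
case=> -[XB _] [Bk [B' [Bk_cell [/mx_cvgP cBk [fB' same]]]]].
have Bk_comp k : in_component i X (Bk k).
  by have [fk [Yk Ck]] := Bk_cell k; exact: cell_in_component.
have i1n : (i.-1 <= n)%N by lia.
have /andP[V'V VV'] := same _ i1n.
have /andP[_ BB'] := same n (leqnn n).
split.
(* The fixed space im x is put in the form [pid_mx r *m B k] with the constant sequence [1%:M]. *)
- apply: submx_trans VV' _; rewrite -[pid_mx n.-1]mulmx1.
  apply: (@entrywise_cvg_submx _ _ _ _ _ (fun k => Vj (Bk k) i.-1) (fun=> 1%:M)).
  + by apply: entrywise_cvg_mul => //; exact: entrywise_cvg_cst.
  + exact: entrywise_cvg_cst.
  + by rewrite row_free_unit unitmx1.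
  + by move=> k; rewrite mulmx1; have [] := Bk_comp k.
- by move: XB; rewrite /Vj pid_mx_1 mul1mx Xeq.
- apply: submx_trans V'V.
  have sBX : (B *m X <= B' *m X)%MS.
    by apply: submxMr; move: BB'; rewrite /Vj pid_mx_1 !mul1mx.
  apply: submx_trans sBX _.
  apply: (entrywise_cvg_submx _ cBk fB' (A := fun k => Bk k *m X)).
    exact: (entrywise_cvg_mul cBk (@entrywise_cvg_cst _ _ _ X)).
  by move=> k; have [] := Bk_comp k.
Qed.

End Components.

Unset Implicit Arguments.
Set Strict Implicit.

Theorem theorem3p1 (R : realType) (n s i : nat) :
  (2 <= n)%N -> (n.-1 <= s)%N ->
  (if (n.-1 < s)%N then (1 <= i <= n)%N else (2 <= i <= n)%N) ->
  forall B : 'M[complex R]_(n, n + s - 1), is_frame B ->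
  (inK i B <->
   [/\ (Vj B i.-1 <= xmap n (n + s - 1))%MS,
       (xmap n (n + s - 1) <= Vj B n)%MS &
       forall v : 'rV[complex R]_(n + s - 1),
         (v <= Vj B n)%MS -> in_preimage (xmap n (n + s - 1)) (Vj B i.-1) v]).
Proof.
move=> n_ge2 le_ns hi B fB.
have le_nN : (2 * n - 2 <= n + s - 1)%N by lia.
have i1n : (1 <= i <= n)%N by case: ifP hi => _ ?; lia.
(* The equality means s = n-1, the case in which [i = 1] is excluded. *)
have i2 : (n + s - 1)%N = (2 * n - 2)%N -> (2 <= i)%N.
  by case: ifP hi => ? ? ?; lia.
have Xeq := xmap_eqmx R n_ge2 le_nN.
have BE : Vj B n = B by rewrite /Vj pid_mx_1 mul1mx.
have compP : in_component i (xmap n (n + s - 1)) B <->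
   [/\ (Vj B i.-1 <= xmap n (n + s - 1))%MS,
       (xmap n (n + s - 1) <= Vj B n)%MS &
       forall v : 'rV[complex R]_(n + s - 1),
         (v <= Vj B n)%MS -> in_preimage (xmap n (n + s - 1)) (Vj B i.-1) v].
  rewrite BE; split=> -[+ + BX]; rewrite !Xeq => VX XB; split=> //.
    by move=> v vB; apply: submx_trans BX; exact: submxMr.
  by apply/row_subP => k; rewrite row_mul; apply: BX; exact: row_sub.
rewrite -compP; split; first exact: closure_in_component.
move=> cB; split; first exact: in_component_inY cB.
exact: component_in_closure.
Qed.
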